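(* Let $Q$ be a connected cluster quiver with $n\ge 3$ vertices, all of them mutable. Then the following are equivalent: - $Q$ is mutation-infinite. - There is no upper bound on the distribution set for $\mathrm{Mut}[Q]$. - There is a quiver in $\mathrm{Mut}[Q]$ having more than $2$ arrows between some two vertices. - For any two distinct vertices of $Q$, the maximal number of arrows between these two vertices of a quiver in $\mathrm{Mut}[Q]$ is infinite (i.e. the number of arrows between these two vertices is unbounded as the quiver ranges over $\mathrm{Mut}[Q]$).
   Context: A cluster quiver is a finite quiver without loops or oriented 2-cycles (multiple arrows allowed). Mutation at a vertex $k$: if there are $m$ arrows $i\to k$ and $n$ arrows $k\to j$, add $mn$ arrows $i\to j$, cancel oriented 2-cycles, and reverse all arrows incident to $k$. Mutation does not change the vertex set. $\mathrm{Mut}[Q]$ is the set of quivers obtained from $Q$ by finite sequences of mutations, considered up to isomorphism; when speaking of arrows between two given vertices of $Q$, one keeps the vertex labels along mutation. $Q$ is mutation-infinite if $\mathrm{Mut}[Q]$ (up to isomorphism) is infinite. The distribution set for $\mathrm{Mut}[Q]$ is $\{|Q'_1| : Q'\in\mathrm{Mut}[Q]\}$, where $|Q'_1|$ is the number of arrows of $Q'$. *)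

(* Defs.v *)
From HB Require Import structures.
From mathcomp Require Import all_boot all_order all_fingroup.
From mathcomp Require Import boolp classical_sets cardinality.

Set Implicit Arguments.
Unset Strict Implicit.
Unset Printing Implicit Defensive.

Local Open Scope classical_set_scope.

(* A quiver on a fixed finite vertex set is recorded by its arrow
   multiplicities: [m (x, y)] is the number of arrows from [x] to [y]. *)
Section Multiplicities.
Variable V : finType.
Implicit Types (m : {ffun V * V -> nat}) (k : V).

Definition no_loops m := [forall x, m (x, x) == 0].

Definition no_2cycles m :=
  [forall x, forall y, (x != y) ==> (m (x, y) == 0) || (m (y, x) == 0)].

Definition is_cluster m := no_loops m && no_2cycles m.

Definition add_paths k m : {ffun V * V -> nat} :=
  [ffun p => m p + m (p.1, k) * m (k, p.2)].

(* Truncated subtraction removes a maximal set of oriented 2-cycles. *)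
Definition cancel_2cycles m : {ffun V * V -> nat} :=
  [ffun p => m p - m (p.2, p.1)].

Definition reverse_at k m : {ffun V * V -> nat} :=
  [ffun p => if (p.1 == k) || (p.2 == k) then m (p.2, p.1) else m p].

Definition mutate_mult k m := reverse_at k (cancel_2cycles (add_paths k m)).

Lemma mutate_mult_cluster k m : is_cluster (mutate_mult k m).
Proof.
apply/andP; split; apply/forallP => x; first by rewrite !ffunE subnn if_same.
apply/forallP => y; apply/implyP => _; rewrite !ffunE /= orbC.
set a := m (x, y) + _; set b := m (y, x) + _.
by case: ifP; rewrite orbC => ->; rewrite !subn_eq0 leq_total.
Qed.

End Multiplicities.

Record quiver (V : finType) := Quiver {
  mult : {ffun V * V -> nat};
  _ : is_cluster mult
}.

HB.instance Definition _ (V : finType) := [isSub for @mult V].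
HB.instance Definition _ (V : finType) := [Choice of quiver V by <:].

Section Quivers.
Variable V : finType.
Implicit Types (Q : quiver V) (k x y : V).

Definition arr Q x y : nat := mult Q (x, y).

Definition arrows_between Q x y : nat := arr Q x y + arr Q y x.

Definition nb_arrows Q : nat := \sum_(x : V) \sum_(y : V) arr Q x y.

Definition quiver_connected Q : Prop :=
  forall x y, connect (fun u v => 0 < arrows_between Q u v) x y.

Definition mutate Q k : quiver V := Quiver (mutate_mult_cluster k (mult Q)).

(* Vertex labels are kept along mutation. *)
Definition labelled_mut Q : set (quiver V) :=
  [set Q' | exists s : seq V, Q' = foldl mutate Q s].

Definition quiver_iso Q1 Q2 : Prop :=
  exists s : {perm V}, forall x y, arr Q2 (s x) (s y) = arr Q1 x y.

Definition iso_class Q : set (quiver V) := [set Q' | quiver_iso Q Q'].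

Definition Mut Q : set (set (quiver V)) :=
  [set iso_class Q' | Q' in labelled_mut Q].

Definition mutation_infinite Q : Prop := infinite_set (Mut Q).

(* Isomorphic quivers have equally many arrows, so labelled representatives
   yield the same set as isomorphism classes. *)
Definition distribution_set Q : set nat :=
  [set nb_arrows Q' | Q' in labelled_mut Q].

End Quivers.

(* Main.v *)
Require Import Defs.
From mathcomp Require Import all_boot all_order all_fingroup.
From mathcomp Require Import boolp classical_sets cardinality.
From mathcomp Require Import zify.

(** Only one implication is combinatorial: a pair joined by at least three
    arrows somewhere in the mutation class forces every pair to be joined by
    arbitrarily many.  The others come from counting: there are finitely many
    quivers with a given bound on the number of arrows, and isomorphic quivers
    have equally many arrows.

    Suppose that at least three arrows [a] join [x] to [y], and that [w] is a
    third vertex adjacent to [x] or [y].  Mutating alternately at [x] and [y]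
    keeps [a], while the signed multiplicities between [w] and the two
    vertices run through a sequence with [c_(n+1) = a * c_n - c_(n-1)].  As
    [a] is at least 3 this at least doubles at each step once it has started
    to grow, in one of the two time directions, so both multiplicities tend to
    infinity ([spiral_step], [spiral_start], [heavy_grows]).  A vertex with no
    arrow to [x] or [y] keeps all its arrows meanwhile ([foldl_mutate_far]).

    To make the pair [x], [v] heavy, follow a path that leads from a neighbour
    [w] of the heavy pair [x], [y] to [v].  If no other vertex of the path
    touches the pair, growing the pair [x], [w] leaves the rest of the path
    intact, and the new heavy pair is closer to [v]; otherwise the path can be
    shortened ([heavy_along_path]).  Mutation preserves connectedness
    ([mutate_connected]), so this can be repeated: first one end of the heavy
    pair is moved to one of two prescribed vertices, then the other end to the
    second ([arrows_unbounded]).  The last move has to be an actual growth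
    step, which is where the existence of a third vertex enters. *)

Set Implicit Arguments.
Unset Strict Implicit.
Unset Printing Implicit Defensive.

Local Open Scope classical_set_scope.

(** * Mutation of a single pair *)

Section Mutation.
Context {V : finType}.
Local Notation mutate_seq := (foldl (@mutate V)).
Implicit Types (Q : quiver V) (d : bool) (k u v w x y z : V) (s p : seq V).

(** Growth may have to be run in the opposite quiver; as mutation commutes with
    reversing all arrows, [d] lets both cases share one computation. *)
Definition dir_arr d Q x y := if d then arr Q x y else arr Q y x.

Lemma arr_loop Q x : arr Q x x = 0.
Proof. by rewrite /arr; case: Q => m /= /andP[/forallP/(_ x)/eqP]. Qed.

Lemma arr_2cycle Q x y : (arr Q x y == 0) || (arr Q y x == 0).
Proof.
have [->|xy] := eqVneq x y; first by rewrite arr_loop.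
rewrite /arr; case: Q => m /= /andP[_ /forallP/(_ x)/forallP/(_ y)].
by rewrite xy.
Qed.

Lemma dir_arr_loop d Q x : dir_arr d Q x x = 0.
Proof. by case: d; apply: arr_loop. Qed.

Lemma dir_arr_2cycle d Q x y : (dir_arr d Q x y == 0) || (dir_arr d Q y x == 0).
Proof. by case: d; apply: arr_2cycle. Qed.

Lemma dir_arr_mutate d Q k x y :
  dir_arr d (mutate Q k) x y =
  if (x == k) || (y == k) then dir_arr d Q y x
  else (dir_arr d Q x y + dir_arr d Q x k * dir_arr d Q k y)
       - (dir_arr d Q y x + dir_arr d Q y k * dir_arr d Q k x).
Proof.
have H x' y' : arr (mutate Q k) x' y' =
  if (x' == k) || (y' == k) then arr Q y' x'
  else (arr Q x' y' + arr Q x' k * arr Q k y')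
       - (arr Q y' x' + arr Q y' k * arr Q k x').
  rewrite /arr /= /mutate_mult /reverse_at /cancel_2cycles /add_paths !ffunE /=.
  case: ifP => // /orP xy.
  (* A path through [k] that starts or ends at [k] would use a loop. *)
  have L z : mult Q (z, z) = 0 by apply: arr_loop.
  have T := arr_2cycle Q x' y'; rewrite /arr in T.
  by case: xy => /eqP xy; move: T; rewrite xy !L; nia.
case: d; rewrite /dir_arr H //.
by rewrite orbC; congr (if _ then _ else _ + _ - (_ + _)); rewrite mulnC.
Qed.

Lemma arrows_betweenE d Q x y :
  arrows_between Q x y = dir_arr d Q x y + dir_arr d Q y x.
Proof. by case: d; rewrite // addnC. Qed.

Lemma arrows_betweenC Q x y : arrows_between Q x y = arrows_between Q y x.
Proof. by rewrite /arrows_between addnC. Qed.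

Lemma arrows_between_mutate_at Q k x :
  arrows_between (mutate Q k) x k = arrows_between Q x k.
Proof. by rewrite !(arrows_betweenE true) !dir_arr_mutate eqxx orbT addnC. Qed.

Lemma mutate_far Q k v u :
  v != k -> arrows_between Q k v = 0 ->
  arrows_between (mutate Q k) u v = arrows_between Q u v.
Proof.
move=> vk /eqP; rewrite addn_eq0 => /andP[/eqP kv0 /eqP vk0].
have [->|uk] := eqVneq u k.
  by rewrite !(arrows_betweenC _ k v) arrows_between_mutate_at.
rewrite !(arrows_betweenE true) !dir_arr_mutate (negPf vk) (negPf uk) /=.
rewrite kv0 vk0 muln0 mul0n !addn0.
by have := arr_2cycle Q u v; lia.
Qed.

Lemma foldl_mutate_far Q s v u :
  v \notin s -> (forall k, k \in s -> arrows_between Q k v = 0) ->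
  arrows_between (mutate_seq Q s) u v = arrows_between Q u v.
Proof.
elim: s Q => // k s IH Q; rewrite inE negb_or => /andP[vk vs] far.
have far_k := far k (mem_head k s).
rewrite IH // ?mutate_far // => l ls.
by rewrite mutate_far // far // inE ls orbT.
Qed.

(** * Connectedness *)

Definition adjacent Q : rel V := fun u v => 0 < arrows_between Q u v.

(** An edge away from [k] can only disappear by cancelling against paths
    through [k], and the edges of those paths survive. *)
Lemma mutate_connected Q k : quiver_connected Q -> quiver_connected (mutate Q k).
Proof.
move=> Qc x y; apply: connect_sub (Qc x y) => {x y} u v uv.
have [uv'|] := boolP (adjacent (mutate Q k) u v); first exact: connect1.
rewrite -eqn0Ngt => uv0.
have [uk|uk] := eqVneq u k.
  by move: uv uv0; rewrite uk !(arrows_betweenC _ k) arrows_between_mutate_at; lia.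
have [vk|vk] := eqVneq v k.
  by move: uv uv0; rewrite vk arrows_between_mutate_at; lia.
suff [uk1 kv1] : adjacent Q u k /\ adjacent Q v k.
  apply: (@connect_trans _ _ k); apply: connect1.
    by rewrite arrows_between_mutate_at.
  by rewrite arrows_betweenC arrows_between_mutate_at.
move: uv uv0; rewrite /adjacent !(arrows_betweenE true) !dir_arr_mutate.
rewrite (negPf vk) (negPf uk) /= => uv uv0.
have acyc := arr_2cycle Q u v.
by split; rewrite lt0n; apply/negP; rewrite addn_eq0 => /andP[/eqP e1 /eqP e2];
  move: uv0; rewrite e1 e2 ?muln0 ?mul0n; lia.
Qed.

Lemma foldl_mutate_connected Q s :
  quiver_connected Q -> quiver_connected (mutate_seq Q s).
Proof. by elim: s Q => //= k s IH Q Qc; apply: IH; apply: mutate_connected. Qed.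

(** * Growth along a heavy pair *)

(** The state from which mutating at [y], then [x], then [y] and so on makes
    the arrows at [w] grow: a mutation at [y] adds more arrows from [x] to [w]
    than those from [w] to [x] can cancel. *)
Definition spiral d Q x y w :=
  [/\ 2 < dir_arr d Q x y, 0 < dir_arr d Q y w
    & dir_arr d Q w x <= dir_arr d Q y w].

Lemma spiral_step d Q x y w :
  w != y -> spiral d Q x y w ->
  spiral d (mutate Q y) y x w /\
  2 * dir_arr d Q y w <= dir_arr d (mutate Q y) x w.
Proof.
move=> wy [a q p].
have xy : x != y by apply/eqP => xy; move: a; rewrite xy dir_arr_loop.
have E := dir_arr_mutate d Q y; rewrite /spiral !E !eqxx orbT.
rewrite (negPf xy) (negPf wy) /=.
have := dir_arr_2cycle d Q y w; have := dir_arr_2cycle d Q x y.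
have : 3 * dir_arr d Q y w <= dir_arr d Q x y * dir_arr d Q y w.
  by rewrite leq_mul2r a orbT.
by move: a q p => a q p le3 /orP[/eqP e1|/eqP e1] /orP[/eqP e2|/eqP e2];
  rewrite ?e1 ?e2 ?muln0 ?mul0n in a q p le3 *; split; try split; lia.
Qed.

Lemma spiral_grows d n Q x y w :
  w != x -> w != y -> spiral d Q x y w ->
  exists2 s, {subset s <= [:: x; y]} &
    forall z, z \in [:: x; y] -> n < arrows_between (mutate_seq Q s) z w.
Proof.
move=> wx wy sp; suff [s sxy H] : exists2 s, {subset s <= [:: x; y]} &
    forall z, z \in [:: x; y] ->
    dir_arr d Q y w + n <= arrows_between (mutate_seq Q s) z w.
  exists s => // z /H; apply: leq_trans.
  by case: sp => _ q _; rewrite -{1}(add0n n) ltn_add2r.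
elim: n Q x y wx wy sp => [|n IH] Q x y wx wy sp.
  exists [:: y]; first by move=> z; rewrite !inE orbC => ->.
  have [_ le2] := spiral_step wy sp.
  move=> z; rewrite !inE addn0 => /orP[] /eqP -> /=.
    by rewrite (arrows_betweenE d); lia.
  rewrite arrows_betweenC arrows_between_mutate_at arrows_betweenC.
  by rewrite (arrows_betweenE d) leq_addr.
have [sp' le2] := spiral_step wy sp.
have [s sxy H] := IH _ _ _ wy wx sp'.
exists (y :: s).
  move=> z; rewrite !inE => /orP[->|/sxy]; first by rewrite orbT.
  by rewrite !inE orbC.
move=> z zxy /=; apply: leq_trans (H z _); last by rewrite !inE orbC in zxy *.
by case: sp => _ q _; lia.
Qed.

(** Put [x] at the tail of the heavy arrows.  If [w] already lies on an
    oriented path with them, then the larger of its two multiplicities decides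
    whether the triple grows in [Q] or in the opposite quiver; otherwise one
    mutation creates such a path. *)
Lemma spiral_start Q x y w :
  w != x -> w != y -> 2 < arr Q x y -> adjacent Q x w || adjacent Q y w ->
  exists2 s, {subset s <= [:: x; y]} &
    exists d, spiral d (mutate_seq Q s) x y w \/
              spiral d (mutate_seq Q s) y x w.
Proof.
move=> wx wy a touch.
have xy : x != y by apply/eqP => xy; move: a; rewrite xy arr_loop.
have [wx0|wx0] := posnP (arr Q w x); have [yw0|yw0] := posnP (arr Q y w).
- have [xw0|xw0] := posnP (arr Q x w).
  + exists [:: x]; first by move=> z; rewrite !inE => ->.
    exists false; left; rewrite /spiral !dir_arr_mutate /dir_arr !eqxx orbT.
    rewrite (negPf wx) (eq_sym y) (negPf xy) /=.
    rewrite wx0 yw0 xw0; split=> //.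
    move: touch; rewrite /adjacent /arrows_between wx0 xw0 yw0.
    by lia.
  + exists [:: y]; first by move=> z; rewrite !inE orbC => ->.
    exists true; right; rewrite /spiral !dir_arr_mutate /dir_arr !eqxx orbT.
    rewrite (negPf wy) (negPf xy) /=.
    rewrite wx0 yw0; have := arr_2cycle Q x y; split; nia.
- by exists [::] => //; exists true; left; rewrite /spiral /dir_arr wx0.
- exists [::] => //; exists false; right.
  by rewrite /spiral /dir_arr yw0.
exists [::] => //; have [le|/ltnW le] := leqP (arr Q w x) (arr Q y w).
  by exists true; left.
by exists false; right.
Qed.

Lemma heavy_grows n Q x y w :
  w != x -> w != y -> 2 < arrows_between Q x y ->
  adjacent Q x w || adjacent Q y w ->
  exists2 s, {subset s <= [:: x; y]} &
    forall z, z \in [:: x; y] -> n < arrows_between (mutate_seq Q s) z w.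
Proof.
move=> wx wy heavy touch.
wlog a : x y wx wy heavy touch / 2 < arr Q x y => [wl|].
  have [/wl|le2] := ltnP 2 (arr Q x y); first exact.
  have swap z : (z \in [:: x; y]) = (z \in [:: y; x]) by rewrite !inE orbC.
  have [] := wl y x wy wx; first by rewrite arrows_betweenC.
  - by rewrite orbC.
  - by move: heavy (arr_2cycle Q x y); rewrite /arrows_between; lia.
  - move=> s sxy H; exists s => [z /sxy|z]; first by rewrite swap.
    by rewrite swap; apply: H.
have [s sxy [d sp]] := spiral_start wx wy a touch.
have [t txy H] : exists2 t, {subset t <= [:: x; y]} &
    forall z, z \in [:: x; y] ->
      n < arrows_between (mutate_seq (mutate_seq Q s) t) z w.
  case: sp => sp; first exact: spiral_grows wx wy sp.
  have [t txy H] := spiral_grows n wy wx sp.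
  exists t => z; first by move/txy; rewrite !inE orbC.
  by move=> zxy; apply: H; rewrite !inE orbC in zxy *.
exists (s ++ t); first by move=> z; rewrite mem_cat => /orP[/sxy|/txy].
by move=> z /H; rewrite foldl_cat.
Qed.

(** * Moving the heavy pair *)

(** By induction on the path, for varying [y]: the new heavy pair keeps the end
    [x], and [2 <= n] is what makes it heavy. *)
Lemma heavy_along_path n Q x y v w p :
  2 <= n -> 2 < arrows_between Q x y -> v != x -> v != y ->
  adjacent Q x w || adjacent Q y w -> path (adjacent Q) w p -> v = last w p ->
  exists s, n < arrows_between (mutate_seq Q s) x v.
Proof.
move=> n2; have [m] := ubnP (size p).
elim: m Q y w p => // m IH Q y w p le_m heavy vx vy touch wp vE.
have [/hasP[t tp t_touch]|/hasPn far] :=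
    boolP (has (fun t => adjacent Q x t || adjacent Q y t) p).
  case/splitPr: tp wp vE le_m => p1 p2.
  rewrite cat_path last_cat /= size_cat /= => /and3P[_ _ p2P] vE le_m.
  by apply: IH heavy vx vy t_touch p2P vE; lia.
(* No vertex of [p] touches the heavy pair, so [w] is not one of its ends. *)
have w_end z : z \in [:: x; y] -> w != z.
  move=> zxy; apply/eqP => wz; case: p wp vE far {le_m} => [|t p] /=.
    by move=> _ vw; move: zxy vx vy; rewrite !inE -wz vw => /orP[] ->.
  case/andP => wt _ _ /(_ t (mem_head _ _)); case/negP.
  by move: zxy wt; rewrite !inE -wz => /orP[] /eqP ->  ->; rewrite ?orbT.
have wx : w != x by apply: w_end; rewrite !inE eqxx.
have wy : w != y by apply: w_end; rewrite !inE eqxx orbT.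
have [s sxy grow] := heavy_grows n wx wy heavy touch.
have {}grow := grow x (mem_head _ _).
case: p wp vE far le_m => [|t p] /=; first by move=> _ -> _ _; exists s.
move=> /andP[wt tp] vE far le_m.
have [vw|vw] := eqVneq v w; first by exists s; rewrite vw.
have keep u z : z \in t :: p ->
    adjacent (mutate_seq Q s) u z = adjacent Q u z.
  move=> ztp; have := far z ztp; rewrite negb_or /adjacent -!eqn0Ngt.
  case/andP => xz yz; rewrite foldl_mutate_far //.
    apply/negP => /sxy; rewrite !inE => /orP[] /eqP zE.
      by move: heavy yz; rewrite zE arrows_betweenC; lia.
    by move: heavy xz; rewrite zE; lia.
  by move=> k /sxy; rewrite !inE => /orP[] /eqP ->; apply/eqP.
have [|||||s' grow'] // := IH (mutate_seq Q s) w t p _ _ vx vw.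
- exact: leq_trans grow.
- by rewrite [adjacent _ w t]keep ?mem_head // wt orbT.
- have sub (u : V) q : {subset q <= t :: p} ->
      path (adjacent Q) u q -> path (adjacent (mutate_seq Q s)) u q.
    elim: q u => //= z q IHq u qp /andP[uz zq].
    rewrite keep ?uz ?IHq ?qp ?mem_head // => r rq.
    by apply: qp; rewrite inE rq orbT.
  by apply: sub tp => z zp; rewrite inE zp orbT.
by exists (s ++ s'); rewrite foldl_cat.
Qed.

Lemma heavy_move n Q x y v :
  quiver_connected Q -> 2 < arrows_between Q x y -> v != x -> v != y ->
  exists s, n < arrows_between (mutate_seq Q s) x v.
Proof.
move=> Qc heavy vx vy; have /connectP[p yp vE] := Qc y v.
have [s grow] : exists s, n + 2 < arrows_between (mutate_seq Q s) x v.
  apply: (heavy_along_path _ heavy vx vy _ yp vE); first exact: leq_addl.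
  by apply/orP; left; apply: leq_trans heavy.
by exists s; apply: leq_ltn_trans grow; apply: leq_addr.
Qed.

(** With the heavy pair ending at [u] and possibly at [v] too, detouring
    through a third vertex makes the last move a growth step. *)
Lemma arrows_unbounded_from n Q u y v :
  3 <= #|V| -> quiver_connected Q -> 2 < arrows_between Q u y -> v != u ->
  exists s, n < arrows_between (mutate_seq Q s) u v.
Proof.
move=> cardV Qc heavy vu.
have [yv|vy] := eqVneq v y; last exact: heavy_move vu vy.
have [w wuv] : exists w, w \notin [set u; v]%SET.
  apply/existsP; apply: contraTT cardV; rewrite negb_exists -leqNgt => /forallP H.
  have /leq_trans -> // : #|V| <= #|[set u; v]%SET|.
    by apply/subset_leq_card/fintype.subsetP => w _; have := H w; rewrite negbK.
  by rewrite cards2; case: (u != v).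
move: wuv; rewrite !inE negb_or => /andP[wu wv].
have [|s hs] := heavy_move 2 Qc heavy wu; first by rewrite -yv.
have [|t ht] := heavy_move n (foldl_mutate_connected s Qc) hs vu.
  by rewrite eq_sym.
by exists (s ++ t); rewrite foldl_cat.
Qed.

Lemma arrows_unbounded n Q x y u v :
  3 <= #|V| -> quiver_connected Q -> 2 < arrows_between Q x y -> u != v ->
  exists s, n < arrows_between (mutate_seq Q s) u v.
Proof.
move=> cardV Qc heavy uv; rewrite eq_sym in uv.
have [ux|ux] := eqVneq u x.
  by rewrite -ux in heavy; apply: arrows_unbounded_from heavy uv.
have [s] := arrows_unbounded_from 2 cardV Qc heavy ux.
rewrite arrows_betweenC => hs.
have [t ht] :=
  arrows_unbounded_from n cardV (foldl_mutate_connected s Qc) hs uv.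
by exists (s ++ t); rewrite foldl_cat.
Qed.

(** * Counting quivers *)

Lemma arr_le_nb Q x y : arr Q x y <= nb_arrows Q.
Proof. by rewrite /nb_arrows (bigD1 x) //= (bigD1 y) //= -addnA leq_addr. Qed.

Lemma arrows_between_le_nb Q x y : arrows_between Q x y <= nb_arrows Q.
Proof.
have := arr_le_nb Q x y; have := arr_le_nb Q y x; have := arr_2cycle Q x y.
by rewrite /arrows_between; lia.
Qed.

Lemma nb_arrows_iso Q Q' : quiver_iso Q Q' -> nb_arrows Q' = nb_arrows Q.
Proof.
case=> s H; rewrite /nb_arrows (reindex_inj (@perm_inj _ s)) /=.
apply: eq_bigr => x _; rewrite (reindex_inj (@perm_inj _ s)) /=.
by apply: eq_bigr => y _; apply: H.
Qed.

Lemma iso_refl Q : quiver_iso Q Q.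
Proof. by exists 1%g => x y; rewrite !perm1. Qed.

Lemma finite_nb_arrows n : finite_set [set Q : quiver V | nb_arrows Q <= n].
Proof.
case: (pselect (exists Q0 : quiver V, True)) => [[Q0 _]|noQ]; last first.
  apply: (@sub_finite_set _ _ set0); last exact: finite_set0.
  by move=> Q _; case: noQ; exists Q.
pose g (f : {ffun V * V -> 'I_n.+1}) : quiver V :=
  insubd Q0 [ffun p => f p : nat].
apply: (@sub_finite_set _ _ (g @` setT)); last first.
  by apply: finite_image; apply: finite_finset.
move=> Q /= le_n; exists [ffun p => inord (mult Q p)] => //.
apply: val_inj; rewrite /g /=.
have -> : [ffun p => ([ffun p' => inord (mult Q p')] : {ffun _ -> 'I_n.+1}) p : nat]
          = mult Q.
  apply/ffunP => -[x y]; rewrite !ffunE inordK // ltnS.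
  exact: leq_trans (arr_le_nb Q x y) le_n.
by rewrite valKd.
Qed.

Lemma finite_Mut Q : has_ubound (distribution_set Q) -> finite_set (Mut Q).
Proof.
case=> n ub; apply: finite_image.
apply: sub_finite_set (finite_nb_arrows n) => Q' Q'm /=.
by rewrite -leEnat; apply: ub; exists Q'.
Qed.

Lemma has_ubound_distribution Q :
  finite_set (Mut Q) -> has_ubound (distribution_set Q).
Proof.
move=> fM; pose h (C : set (quiver V)) := nb_arrows (xget Q C).
have /finite_seqP[s sE] := finite_image h fM.
exists (\max_(i <- s) i) => _ [Q' Q'm <-]; rewrite leEnat.
apply: (@leq_bigmax_seq _ _ xpredT id) => //.
suff : (h @` Mut Q) (nb_arrows Q') by rewrite sE.
exists (iso_class Q'); first by exists Q'.
apply: nb_arrows_iso; apply: (@xgetPex _ Q (iso_class Q')).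
by exists Q'; apply: iso_refl.
Qed.

Lemma has_ubound_light Q :
  (forall Q', labelled_mut Q Q' ->
     forall x y, x <> y -> arrows_between Q' x y <= 2) ->
  has_ubound (distribution_set Q).
Proof.
move=> light; exists (\sum_(x : V) \sum_(y : V) 2) => _ [Q' Q'm <-].
rewrite leEnat; apply: leq_sum => x _; apply: leq_sum => y _.
have [->|/eqP xy] := eqVneq x y; first by rewrite arr_loop.
by apply: leq_trans (light Q' Q'm x y xy); apply: leq_addr.
Qed.

End Mutation.

Theorem corollary5p7 (V : finType) (Q : quiver V)
    (cardV : 3 <= #|V|) (Qconn : quiver_connected Q) :
  [<-> mutation_infinite Q;
       ~ has_ubound (distribution_set Q);
       exists2 Q' : quiver V, labelled_mut Q Q' &
         exists x y : V, x <> y /\ 2 < arrows_between Q' x y;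
       forall x y : V, x <> y ->
         ~ has_ubound [set arrows_between Q' x y | Q' in labelled_mut Q]].
Proof.
tfae.
- by move=> infM /finite_Mut.
- move=> unb; apply: contrapT => light; apply: unb; apply: has_ubound_light.
  move=> Q' Q'm x y xy; rewrite leqNgt; apply/negP => heavy.
  by apply: light; exists Q' => //; exists x, y.
- case=> Q' [s ->] [x [y [_ heavy]]] u v /eqP uv [n ub].
  have [t] := arrows_unbounded n cardV (foldl_mutate_connected s Qconn) heavy uv.
  rewrite ltnNge => /negP; apply; rewrite -leEnat; apply: ub.
  by exists (foldl (@mutate V) (foldl (@mutate V) Q s) t) => //; exists (s ++ t);
     rewrite foldl_cat.
- move=> unb /has_ubound_distribution[n ub].
  have [x [y xy]] : exists x y : V, x <> y.
    have /card_gt1P[x [y [_ _ /eqP xy]]] : 1 < #|V| by apply: leq_trans cardV.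
    by exists x, y.
  apply: (unb x y xy); exists n => _ [Q' Q'm <-].
  rewrite leEnat; apply: leq_trans (arrows_between_le_nb Q' x y) _.
  by rewrite -leEnat; apply: ub; exists Q'.
Qed.
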